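(* Let $t\in\mathbb R\setminus\{0\}$ and let $\alpha\in\mathbb N_0^3$. Then on every open set $\Omega\subset\mathbb H_t^*$ the function $\mu_t^\alpha$ is in the kernel of $V_t$, that is, $$V_t\,\mu_t^\alpha(x)=0\qquad\text{for every }x\in\Omega .$$
   Context: For $t\in\mathbb R\setminus\{0\}$, $\mathbb H_t$ is the real associative unital algebra with basis $1,i,j_t,k_t$, where $i^2=-1$, $j_t^2=k_t^2=t$, $ij_t=k_t=-j_ti$, $j_tk_t=-ti=-k_tj_t$, $k_ti=j_t=-ik_t$. A point $x=(x_0,x_1,x_2,x_3)\in\mathbb R^4$ is identified with $q_t=x_0+x_1i+x_2j_t+x_3k_t$, and its vector part is $\vec{q_t}=ix_1+j_tx_2+k_tx_3$. $\mathbb H_t^*$ denotes the open set of those $q_t$ for which $\vec{q_t}$ is invertible in $\mathbb H_t$, i.e. $-x_1^2+t(x_2^2+x_3^2)\neq0$; there $\frac{1}{\vec{q_t}}$ denotes the inverse. For a differentiable $\mathbb H_t$-valued function $f$ on an open subset of $\mathbb H_t^*$, $$V_tf=\frac{\partial f}{\partial x_0}-\frac{1}{\vec{q_t}}\left(x_1\frac{\partial f}{\partial x_1}+x_2\frac{\partial f}{\partial x_2}+x_3\frac{\partial f}{\partial x_3}\right).$$ The $V_t$-Fueter variables are $\mu_{l,t}(x)=x_l\left(1+\frac{x_0}{\vec{q_t}}\right)$, $l=1,2,3$, and for $\alpha=(\alpha_1,\alpha_2,\alpha_3)\in\mathbb N_0^3$ one sets $\mu_t^\alpha(x)=\mu_{1,t}(x)^{\alpha_1}\mu_{2,t}(x)^{\alpha_2}\mu_{3,t}(x)^{\alpha_3}$.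 *)

(* Defs.v *)
From HB Require Import structures.
From mathcomp Require Import all_boot all_order all_algebra.
From mathcomp Require Import ring.
From mathcomp Require Import all_classical all_reals all_analysis.

Set Implicit Arguments.
Unset Strict Implicit.
Unset Printing Implicit Defensive.

Import Order.TTheory GRing.Theory Num.Theory.
Import numFieldNormedType.Exports.

Local Open Scope classical_set_scope.
Local Open Scope ring_scope.

(* The phantom parameter t keeps the algebras for different t apart.  The
   alias inherits the normed topology of R^4, so that an element q is at once
   the point (q 0 0, q 0 1, q 0 2, q 0 3) of R^4 and the number
   q 0 0 + q 0 1 i + q 0 2 j_t + q 0 3 k_t. *)
Definition Ht (R : realType) (t : R) : Type := 'rV[R]_4.

HB.instance Definition _ (R : realType) (t : R) :=
  NormedModule.copy (Ht t) 'rV[R]_4.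

Section Algebra.
Variables (R : realType) (t : R).
Implicit Types (p q : Ht t).

Definition mkHt (a b c d : R) : Ht t := \row_(l < 4) [:: a; b; c; d]`_l.

Definition co (l : 'I_4) (q : Ht t) : R := q ord0 l.

Definition o0 : 'I_4 := Ordinal (isT : (0 < 4)%N).
Definition o1 : 'I_4 := Ordinal (isT : (1 < 4)%N).
Definition o2 : 'I_4 := Ordinal (isT : (2 < 4)%N).
Definition o3 : 'I_4 := Ordinal (isT : (3 < 4)%N).

Definition Ht1 : Ht t := mkHt 1 0 0 0.
Definition Hti : Ht t := mkHt 0 1 0 0.
Definition Htj : Ht t := mkHt 0 0 1 0.
Definition Htk : Ht t := mkHt 0 0 0 1.

(* Bilinear extension of the multiplication table; see Ht_table below. *)
Definition Ht_mul p q : Ht t :=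
  mkHt
    (co o0 p * co o0 q - co o1 p * co o1 q
      + t * (co o2 p * co o2 q) + t * (co o3 p * co o3 q))
    (co o0 p * co o1 q + co o1 p * co o0 q
      - t * (co o2 p * co o3 q) + t * (co o3 p * co o2 q))
    (co o0 p * co o2 q + co o2 p * co o0 q
      - co o1 p * co o3 q + co o3 p * co o1 q)
    (co o0 p * co o3 q + co o3 p * co o0 q
      + co o1 p * co o2 q - co o2 p * co o1 q).

Definition Ht_qnorm q : R :=
  co o0 q ^+ 2 + co o1 q ^+ 2 - t * (co o2 q ^+ 2 + co o3 q ^+ 2).

Definition Ht_unit : pred (Ht t) := fun q => Ht_qnorm q != 0.

(* Total, with the library convention that non-units are left unchanged. *)
Definition Ht_inv q : Ht t :=
  if Ht_unit q then
    (Ht_qnorm q)^-1 *: mkHt (co o0 q) (- co o1 q) (- co o2 q) (- co o3 q)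
  else q.

Lemma HtP p q : co o0 p = co o0 q -> co o1 p = co o1 q ->
  co o2 p = co o2 q -> co o3 p = co o3 q -> p = q.
Proof.
move=> h0 h1 h2 h3; apply/rowP => -[[|[|[|[|//]]]] lt_l].
- by move: h0; rewrite /co (_ : Ordinal lt_l = o0)//; exact: val_inj.
- by move: h1; rewrite /co (_ : Ordinal lt_l = o1)//; exact: val_inj.
- by move: h2; rewrite /co (_ : Ordinal lt_l = o2)//; exact: val_inj.
- by move: h3; rewrite /co (_ : Ordinal lt_l = o3)//; exact: val_inj.
Qed.

Lemma co_mk (l : 'I_4) a b c d : co l (mkHt a b c d) = [:: a; b; c; d]`_l.
Proof. by rewrite /co mxE. Qed.

Lemma coD l p q : co l (p + q) = co l p + co l q.
Proof. by rewrite /co mxE. Qed.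

Lemma coN l p : co l (- p) = - co l p.
Proof. by rewrite /co mxE. Qed.

Lemma coZ l a p : co l (a *: p) = a * co l p.
Proof. by rewrite /co mxE. Qed.

Lemma co0 l : co l (0 : Ht t) = 0.
Proof. by rewrite /co mxE. Qed.

Definition coE := (coD, coN, coZ, co0, co_mk).

Local Ltac Ht_ring :=
  apply: HtP; rewrite ?coE ?/Ht_mul ?/Ht1 ?/Hti ?/Htj ?/Htk ?coE /=; ring.

Lemma Ht_mulA : associative Ht_mul.
Proof. by move=> p q r; Ht_ring. Qed.

Lemma Ht_mul1 : left_id Ht1 Ht_mul.
Proof. by move=> p; Ht_ring. Qed.

Lemma Ht_mulr1 : right_id Ht1 Ht_mul.
Proof. by move=> p; Ht_ring. Qed.

Lemma Ht_mulDl : left_distributive Ht_mul +%R.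
Proof. by move=> p q r; Ht_ring. Qed.

Lemma Ht_mulDr : right_distributive Ht_mul +%R.
Proof. by move=> p q r; Ht_ring. Qed.

Lemma Ht1_neq0 : Ht1 != 0 :> Ht t.
Proof.
by apply/eqP => /(congr1 (co o0))/eqP; rewrite !coE/= oner_eq0.
Qed.

HB.instance Definition _ := GRing.Zmodule_isNzRing.Build (Ht t)
  Ht_mulA Ht_mul1 Ht_mulr1 Ht_mulDl Ht_mulDr Ht1_neq0.

Lemma Ht_mulE p q : p * q = Ht_mul p q.
Proof. by []. Qed.

Lemma Ht_oneE : 1 = Ht1.
Proof. by []. Qed.

Lemma Ht_scalerAl (a : R) p q : a *: (p * q) = (a *: p) * q.
Proof. by rewrite ?(Ht_oneE, Ht_mulE); Ht_ring. Qed.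

HB.instance Definition _ :=
  GRing.Lmodule_isLalgebra.Build R (Ht t) Ht_scalerAl.

Lemma Ht_scalerAr (a : R) p q : a *: (p * q) = p * (a *: q).
Proof. by rewrite ?(Ht_oneE, Ht_mulE); Ht_ring. Qed.

HB.instance Definition _ :=
  GRing.Lalgebra_isAlgebra.Build R (Ht t) Ht_scalerAr.

Lemma Ht_qnormM p q : Ht_qnorm (p * q) = Ht_qnorm p * Ht_qnorm q.
Proof. by rewrite /Ht_qnorm ?(Ht_oneE, Ht_mulE) ?coE /=; ring. Qed.

Lemma Ht_qnorm1 : Ht_qnorm 1 = 1.
Proof. by rewrite /Ht_qnorm ?(Ht_oneE, Ht_mulE) ?coE /=; ring. Qed.

Lemma Ht_mulVr : {in Ht_unit, left_inverse 1 Ht_inv *%R}.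
Proof.
move=> q uq; rewrite /Ht_inv ifT// -scalerAl.
apply/(scalerI uq); rewrite scalerA divff// scale1r.
by rewrite Ht_oneE Ht_mulE /Ht_qnorm; Ht_ring.
Qed.

Lemma Ht_divrr : {in Ht_unit, right_inverse 1 Ht_inv *%R}.
Proof.
move=> q uq; rewrite /Ht_inv ifT// -scalerAr.
apply/(scalerI uq); rewrite scalerA divff// scale1r.
by rewrite Ht_oneE Ht_mulE /Ht_qnorm; Ht_ring.
Qed.

Lemma Ht_unitrP p q : q * p = 1 /\ p * q = 1 -> Ht_unit p.
Proof.
move=> [/(congr1 Ht_qnorm)]; rewrite Ht_qnormM Ht_qnorm1 /Ht_unit => + _.
by apply: contra_eq_neq => ->; rewrite mulr0 eq_sym oner_neq0.
Qed.

Lemma Ht_inv_out : {in [predC Ht_unit], Ht_inv =1 id}.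
Proof. by move=> q uq; rewrite /Ht_inv ifN. Qed.

HB.instance Definition _ := GRing.NzRing_hasMulInverse.Build (Ht t)
  Ht_mulVr Ht_divrr Ht_unitrP Ht_inv_out.

Lemma Ht_table :
  [/\ Hti * Hti = - 1, Htj * Htj = t *: 1 & Htk * Htk = t *: 1] /\
  [/\ Hti * Htj = Htk, Htj * Hti = - Htk, Htj * Htk = - t *: Hti,
      Htk * Htj = t *: Hti & (Htk * Hti = Htj /\ Hti * Htk = - Htj)].
Proof.
by split; split; try split; rewrite ?(Ht_oneE, Ht_mulE); Ht_ring.
Qed.

Lemma Ht_basisE q :
  q = co o0 q *: 1 + co o1 q *: Hti + co o2 q *: Htj + co o3 q *: Htk.
Proof. by rewrite ?(Ht_oneE, Ht_mulE); Ht_ring. Qed.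

Definition vecpart q : Ht t :=
  co o1 q *: Hti + co o2 q *: Htj + co o3 q *: Htk.

Lemma vecpart_unitE q : (vecpart q \is a GRing.unit) =
  (- co o1 q ^+ 2 + t * (co o2 q ^+ 2 + co o3 q ^+ 2) != 0).
Proof.
rewrite unfold_in/= /Ht_unit -oppr_eq0; congr (_ != 0).
by rewrite /Ht_qnorm ?(Ht_oneE, Ht_mulE) ?coE /=; ring.
Qed.

Definition Htstar : set (Ht t) := [set q | vecpart q \is a GRing.unit].

Definition Vt (f : Ht t -> Ht t) (q : Ht t) : Ht t :=
  'D_Ht1 f q - (vecpart q)^-1 *
    (co o1 q *: 'D_Hti f q + co o2 q *: 'D_Htj f q + co o3 q *: 'D_Htk f q).

(* Vt is only meant for differentiable functions ('D_v f is a junk value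
   otherwise), so differentiability is part of lying in the kernel. *)
Definition in_kerVt (Omega : set (Ht t)) (f : Ht t -> Ht t) : Prop :=
  forall q, Omega q -> differentiable f q /\ Vt f q = 0.

Definition mu (l : 'I_4) (q : Ht t) : Ht t :=
  co l q *: (1 + co o0 q *: (vecpart q)^-1).

Definition mupow (a1 a2 a3 : nat) (q : Ht t) : Ht t :=
  mu o1 q ^+ a1 * mu o2 q ^+ a2 * mu o3 q ^+ a3.

End Algebra.

Arguments mupow {R} t a1 a2 a3 q.
Arguments mu {R} t l q.
Arguments Htstar {R} t _.

(* Main.v *)
Require Import Defs.
From HB Require Import structures.
From mathcomp Require Import all_boot all_order all_algebra.
From mathcomp Require Import ring.
From mathcomp Require Import all_classical all_reals all_analysis.
Import GRing.Theory.
Import numFieldNormedType.Exports.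
Local Open Scope classical_set_scope.
Local Open Scope ring_scope.

(* For v the vector part of q and u = v^-1, the operator is
   V_t f (q) = df(1) - u df(v), df being the differential of f at q: the sum of
   the x_l d/dx_l is the derivative in the direction v.  Hence V_t satisfies
   the Leibniz rule on products f g such that f(q) commutes with v.
   Differentiating u v = 1 gives du(1) = 0 and du(v) = -u, so that
   d mu_l(1) = x_l u and d mu_l(v) = x_l: each mu_l is in the kernel.  Since
   mu_l(q) is a real combination of 1 and u, it commutes with v, and the
   Leibniz rule carries the kernel property over to the monomials. *)

Section GeneralDifferential.
Set Implicit Arguments.
Unset Strict Implicit.

(** The first-order expansion at [x] only sees values near [x]. This lets identities that hold only
    where the vector part is invertible be differentiated. *)
Lemma near_eq_is_diff (K : numFieldType) (V W : normedModType K)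
    (f g df : V -> W) (x : V) :
  (\forall y \near x, f y = g y) -> is_diff x f df -> is_diff x g df.
Proof.
move=> fg [dif dfE].
have fgx : f x = g x by exact: nbhs_singleton fg.
have [dc fE] := (diff_locallyP x f).1 dif.
have gE : g \o shift x = cst (g x) + 'd f x +o_ 0 id.
  apply/eqaddoP => e e0; have /eqaddoP/(_ e e0) := fE.
  move: fg; rewrite (near_shift 0 x); apply: filterS2 => y /=.
  by rewrite subr0 !fctE /= fgx => ->.
have dE : 'd g x = 'd f x :> (V -> W) by exact: diff_unique dc gE.
apply: DiffDef; last by rewrite dE.
by apply/diff_locallyP; rewrite dE.
Qed.

Lemma is_diffZl (K : numFieldType) (V W : normedModType K)
    (k dk : V -> K) (w : W) (x : V) :
  is_diff x k dk -> is_diff x (fun z => k z *: w) (fun z => dk z *: w).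
Proof.
by move=> [kx <-]; apply: DiffDef; [exact: differentiableZl|rewrite diffZl].
Qed.

End GeneralDifferential.

Section HtCalculus.
Set Implicit Arguments.
Unset Strict Implicit.

Variables (R : realType) (t : R).
Implicit Types (q : Ht t) (f g df dg : Ht t -> Ht t).

Lemma is_diff_co l q : is_diff q (@co R t l) (co l).
Proof.
have lin : linear (@co R t l) by move=> a x y; rewrite coD coZ.
pose lM := GRing.isLinear.Build _ _ _ _ _ lin.
pose L : {linear Ht t -> R} := HB.pack (@co R t l) lM.
have cL : continuous L by exact: coord_continuous.
apply: DiffDef; first exact: (linear_differentiable q cL).
exact: (diff_lin q cL).
Qed.

(** Expanding along the basis makes [f] a sum of real functions times constant vectors, so
    differentiation reduces to real-valued calculus. *)
Lemma is_diff_coordP f df q :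
  (forall l, is_diff q (co l \o f) (co l \o df)) -> is_diff q f df.
Proof.
move=> fl.
have basisE g : g = ((fun z => (co o0 \o g) z *: 1) +
    (fun z => (co o1 \o g) z *: Hti t) + (fun z => (co o2 \o g) z *: Htj t) +
    (fun z => (co o3 \o g) z *: Htk t)).
  by apply/funext => z; rewrite [LHS]Ht_basisE.
rewrite [f]basisE [df]basisE.
exact: is_diffD (is_diffD (is_diffD (is_diffZl _ (fl o0))
  (is_diffZl _ (fl o1))) (is_diffZl _ (fl o2)))
  (is_diffZl _ (fl o3)).
Qed.

Lemma is_diff_coord f df l q :
  is_diff q f df -> is_diff q (co l \o f) (co l \o df).
Proof. by move=> fq; exact: (is_diff_comp fq (is_diff_co l (f q))). Qed.

(** Each coordinate of a product is a real bilinear form in the coordinates of the factors, so the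
    real product rule applies four times. The order of the factors is kept, since the algebra is not
    commutative. *)
Lemma is_diff_HtM f g df dg q : is_diff q f df -> is_diff q g dg ->
  is_diff q (fun z => f z * g z) (fun z => df z * g q + f q * dg z).
Proof.
move=> fq gq; apply: is_diff_coordP.
have fE l := is_diff_coord l fq.
have gE l := is_diff_coord l gq.
have M l m := is_diffM (fE l) (gE m).
move=> -[[|[|[|[|//]]]] ltl].
- have -> : co (Ordinal ltl) \o (fun z => f z * g z) =
    (co o0 \o f) * (co o0 \o g) - (co o1 \o f) * (co o1 \o g)
    + t *: ((co o2 \o f) * (co o2 \o g)) + t *: ((co o3 \o f) * (co o3 \o g)).
    by apply/funext => z; rewrite /= Ht_mulE /Ht_mul co_mk.
  apply: (is_diff_eq (is_diffD (is_diffD (is_diffB (M o0 o0) (M o1 o1))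
    (is_diffZ t (M o2 o2))) (is_diffZ t (M o3 o3)))); apply/funext => z.
  by rewrite !fctE /= coD !Ht_mulE /Ht_mul !co_mk /= /GRing.scale /=; ring.
- have -> : co (Ordinal ltl) \o (fun z => f z * g z) =
    (co o0 \o f) * (co o1 \o g) + (co o1 \o f) * (co o0 \o g)
    - t *: ((co o2 \o f) * (co o3 \o g)) + t *: ((co o3 \o f) * (co o2 \o g)).
    by apply/funext => z; rewrite /= Ht_mulE /Ht_mul co_mk.
  apply: (is_diff_eq (is_diffD (is_diffB (is_diffD (M o0 o1) (M o1 o0))
    (is_diffZ t (M o2 o3))) (is_diffZ t (M o3 o2)))); apply/funext => z.
  by rewrite !fctE /= coD !Ht_mulE /Ht_mul !co_mk /= /GRing.scale /=; ring.
- have -> : co (Ordinal ltl) \o (fun z => f z * g z) =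
    (co o0 \o f) * (co o2 \o g) + (co o2 \o f) * (co o0 \o g)
    - (co o1 \o f) * (co o3 \o g) + (co o3 \o f) * (co o1 \o g).
    by apply/funext => z; rewrite /= Ht_mulE /Ht_mul co_mk.
  apply: (is_diff_eq (is_diffD (is_diffB (is_diffD (M o0 o2) (M o2 o0))
    (M o1 o3)) (M o3 o1))); apply/funext => z.
  by rewrite !fctE /= coD !Ht_mulE /Ht_mul !co_mk /= /GRing.scale /=; ring.
- have -> : co (Ordinal ltl) \o (fun z => f z * g z) =
    (co o0 \o f) * (co o3 \o g) + (co o3 \o f) * (co o0 \o g)
    + (co o1 \o f) * (co o2 \o g) - (co o2 \o f) * (co o1 \o g).
    by apply/funext => z; rewrite /= Ht_mulE /Ht_mul co_mk.
  apply: (is_diff_eq (is_diffB (is_diffD (is_diffD (M o0 o3) (M o3 o0))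
    (M o1 o2)) (M o2 o1))); apply/funext => z.
  by rewrite !fctE /= coD !Ht_mulE /Ht_mul !co_mk /= /GRing.scale /=; ring.
Qed.

Lemma is_diff_vecpart q : is_diff q (@vecpart R t) (@vecpart R t).
Proof.
exact: is_diffD (is_diffD (is_diffZl _ (is_diff_co o1 q))
  (is_diffZl _ (is_diff_co o2 q)))
  (is_diffZl _ (is_diff_co o3 q)).
Qed.

Lemma differentiable_qnorm_vecpart q :
  differentiable (fun z : Ht t => Ht_qnorm (vecpart z)) q.
Proof.
have -> : (fun z => Ht_qnorm (vecpart z)) = @co R t o1 * @co R t o1
    - t *: (@co R t o2 * @co R t o2 + @co R t o3 * @co R t o3).
  by apply/funext => z; rewrite /Ht_qnorm /vecpart !coE !fctE /= /GRing.scale /=;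
    ring.
have sq l := is_diffM (is_diff_co l q) (is_diff_co l q).
by have [] := is_diffB (sq o1) (is_diffZ t (is_diffD (sq o2) (sq o3))).
Qed.

(** Invertibility of v is the nonvanishing of its quadratic form, which is continuous in [q]. *)
Lemma Htstar_near q : Htstar t q -> \forall z \near q, Htstar t z.
Proof.
move=> uq.
have c := differentiable_continuous (differentiable_qnorm_vecpart q).
exact: (cvgr_neq0 _ c uq).
Qed.

Lemma differentiable_vecpartV q :
  Htstar t q -> differentiable (fun z : Ht t => (vecpart z)^-1) q.
Proof.
move=> uq.
have dV := differentiableV (differentiable_qnorm_vecpart q) uq.
have dN := is_diff_HtM
  (is_diffZl (1 : Ht t) (differentiableP dV)) (is_diffN (is_diff_vecpart q)).
(* The real part of v is 0, so its conjugate is -v and its inverse is -v divided by the quadratic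
   form. *)
suff E : \forall z \near q,
    ((Ht_qnorm (vecpart z))^-1 *: 1) * - vecpart z = (vecpart z)^-1.
  by have [] := near_eq_is_diff E dN.
apply: filterS (Htstar_near uq) => z uz.
rewrite [RHS]/(Ht_inv _) /Ht_inv ifT// -scalerAl mul1r; congr (_ *: _).
by apply: HtP; rewrite /vecpart !coE /=; ring.
Qed.

Lemma is_diff_vecpartV q : Htstar t q ->
  is_diff q (fun z : Ht t => (vecpart z)^-1)
    (fun w => - ((vecpart q)^-1 * vecpart w * (vecpart q)^-1)).
Proof.
move=> uq; have dV := differentiableP (differentiable_vecpartV uq).
apply: (is_diff_eq dV); apply/funext => w.
have dM := is_diff_HtM dV (is_diff_vecpart q).
have /near_eq_is_diff/(_ dM) d1 :
    \forall z \near q, (vecpart z)^-1 * vecpart z = cst 1 z.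
  by apply: filterS (Htstar_near uq) => z uz; rewrite mulVr.
(* The differential of the constant 1 is 0, and by the product rule it is also w -> du(w) v + u
   [vecpart w]; multiplying by u on the right then isolates du(w). *)
have E := etrans (esym (@diff_val _ _ _ _ _ _ _ d1)) (diff_cst _ _).
have /eqP := congr1 (fun h => h w) E.
rewrite /= addr_eq0 => /eqP Ew.
by rewrite -[LHS](mulrK uq) Ew mulNr.
Qed.

Lemma is_diff_mu l q : Htstar t q ->
  is_diff q (mu t l) (fun w => co l w *: (1 + co o0 q *: (vecpart q)^-1) +
    co l q *: (co o0 w *: (vecpart q)^-1 -
      co o0 q *: ((vecpart q)^-1 * vecpart w * (vecpart q)^-1))).
Proof.
move=> uq.
have d0 := is_diff_HtM (is_diffZl (1 : Ht t) (is_diff_co o0 q))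
  (is_diff_vecpartV uq).
have d := is_diff_HtM (is_diffZl (1 : Ht t) (is_diff_co l q))
  (is_diffD (is_diff_cst (1 : Ht t) q) d0).
(* Real scalars are written as multiples of 1 in the algebra, so that the product rule [is_diff_HtM]
   covers them too. *)
have -> : mu t l = (fun z => (co l z *: 1) *
    (cst 1 + (fun z => (co o0 z *: 1) * (vecpart z)^-1)) z).
  by apply/funext => z; rewrite /mu fctE /= -!scalerAl !mul1r.
apply: (is_diff_eq d); apply/funext => w.
by rewrite !fctE /= add0r -!scalerAl !mul1r scalerN.
Qed.

Lemma VtE f df q : is_diff q f df ->
  Vt f q = df 1 - (vecpart q)^-1 * df (vecpart q).
Proof.
by move=> [fq <-]; rewrite /Vt !deriveE// /vecpart !linearD !linearZ.
Qed.

(** The product rule produces u f(q) dg(v). As f(q) commutes with v, it commutes with u, and this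
    term becomes f(q) u dg(v). *)
Lemma VtM f g q : differentiable f q -> differentiable g q ->
  GRing.comm (f q) (vecpart q) ->
  Vt (fun z => f z * g z) q = Vt f q * g q + f q * Vt g q.
Proof.
move=> /differentiableP df /differentiableP dg /commrV cf.
rewrite (VtE (is_diff_HtM df dg)) (VtE df) (VtE dg).
rewrite mulrBl mulrBr mulrDr opprD.
by rewrite !mulrA -cf addrACA.
Qed.

(** Working on the singleton of [q] makes kernel membership a pointwise property, matching a
    commutation hypothesis stated at [q] alone. *)
Lemma in_kerVtM f g q : GRing.comm (f q) (vecpart q) ->
  in_kerVt [set q] f -> in_kerVt [set q] g ->
  in_kerVt [set q] (fun z => f z * g z).
Proof.
move=> cf /(_ _ erefl)[df Vf] /(_ _ erefl)[dg Vg] _ ->.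
split; last by rewrite VtM// Vf Vg mul0r mulr0 addr0.
by have [] := is_diff_HtM (differentiableP df) (differentiableP dg).
Qed.

Lemma in_kerVtX f n q : GRing.comm (f q) (vecpart q) ->
  in_kerVt [set q] f -> in_kerVt [set q] (fun z => f z ^+ n).
Proof.
move=> cf kf; elim: n => [|n IHn].
  move=> _ ->; split; first exact: differentiable_cst.
  by rewrite (VtE (is_diff_cst (1 : Ht t) q)) mulr0 subr0.
(* The single factor [f] is split off on the left, where its commutation with v is what the product
   lemma asks for. *)
under eq_fun do rewrite exprS.
exact: in_kerVtM.
Qed.

Lemma comm_mu_vecpart l q : Htstar t q -> GRing.comm (mu t l q) (vecpart q).
Proof.
move=> uq; rewrite /GRing.comm /mu -scalerAl -scalerAr; congr (_ *: _).
by rewrite mulrDl [RHS]mulrDr mul1r mulr1 -scalerAl -scalerAr mulVr// divrr.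
Qed.

Lemma co_vecpart l q : l != o0 -> co l (vecpart q) = co l q.
Proof.
by case: l => -[|[|[|[|//]]]] ltl // _; rewrite /vecpart !coE /=
  ?mulr0 ?mulr1 ?addr0 ?add0r; congr (co _ q); exact: val_inj.
Qed.

Lemma co0_vecpart q : co o0 (vecpart q) = 0.
Proof. by rewrite /vecpart !coE /= !mulr0 !addr0. Qed.

Lemma vecpartK q : vecpart (vecpart q) = vecpart q.
Proof. by rewrite [LHS]/vecpart !co_vecpart. Qed.

Lemma co_one l : l != o0 -> co l (1 : Ht t) = 0.
Proof. by case: l => -[|[|[|[|//]]]] ltl // _; rewrite Ht_oneE /Ht1 co_mk. Qed.

Lemma vecpart1 : vecpart (1 : Ht t) = 0.
Proof. by rewrite /vecpart !co_one// !scale0r !addr0. Qed.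

Lemma mu_in_kerVt l q : l != o0 -> Htstar t q -> in_kerVt [set q] (mu t l).
Proof.
move=> l0 uq _ ->; have dmu := is_diff_mu l uq.
have [dl _] := dmu; split=> //.
rewrite (VtE dmu) co_one// co_vecpart// co0_vecpart vecpart1 vecpartK.
rewrite Ht_oneE /Ht1 co_mk /= -/(Ht1 t) -Ht_oneE mulr0 mul0r scaler0 subr0.
rewrite !scale0r add0r scale1r sub0r mulVr// mul1r.
(* After u v u = u, the two terms in x_0 u cancel; what is left is x_l u - u x_l. *)
by rewrite scalerN scalerDr -addrA addrN addr0 -scalerAr mulr1 addrN.
Qed.

End HtCalculus.

Theorem theorem3p4 (R : realType) (t : R) (ht : t != 0)
  (a1 a2 a3 : nat) (Omega : set (Ht t))
  (openOmega : open Omega) (subOmega : Omega `<=` Htstar t) :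
  in_kerVt Omega (mupow t a1 a2 a3).
Proof.
move=> q /subOmega uq.
have c l n : GRing.comm (mu t l q ^+ n) (vecpart q).
  exact/commr_sym/commrX/commr_sym/comm_mu_vecpart.
have k l n : l != o0 -> in_kerVt [set q] (fun z => mu t l z ^+ n).
  by move=> l0; apply: in_kerVtX; [exact: comm_mu_vecpart|exact: mu_in_kerVt].
apply: (in_kerVtM _ (in_kerVtM _ (k _ a1 _) (k _ a2 _)) (k _ a3 _)) => //.
(* The left factor of the outer product is itself a product of two powers, each commuting with v. *)
exact/commr_sym/commrM/commr_sym/c/commr_sym/c.
Qed.
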